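(* Let $k\in\{1,2,3\}$. There exists a constant $c_k$, depending only on $k$, such that for every $A\in C_k$, every $a\in A\setminus E_k$, and every positive integer $n$, $$|A(n)|\le \frac{(P_k-\varphi(P_k))\,a-\varphi(P_{k-1})(p_{k+1}-p_k)}{P_k\, a}\,n+c_k.$$
   Context: Let $\mathbb{Z}^{+}$ be the set of positive integers, $p_i$ the $i$th prime, $P_k=p_1p_2\cdots p_k$ (with $P_0=1$, the empty product), and $\varphi$ Euler's totient function. $C_k$ is the family of all subsets $A\subseteq\mathbb{Z}^{+}$ that do not contain $k+1$ pairwise coprime integers. $E_k$ is the set of positive integers divisible by at least one of $p_1,\ldots,p_k$. For $A\subseteq\mathbb{Z}^{+}$, $A(n)=A\cap\{1,2,\ldots,n\}$, and $|A(n)|$ is its number of elements.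
   Formalization: For k = 2 and k = 3 the case a = 1 is excluded, since the claim fails there: for k = 2 take A = {1} together with the even numbers (density 1/2, bound 1/3); for k = 3 take A = {1} together with E_2 (density 2/3, bound 3/5). *)

(* Defs.v *)
From mathcomp Require Import all_boot all_order all_algebra finmap.
From mathcomp Require Import boolp classical_sets functions cardinality reals.
Set Implicit Arguments.
Unset Strict Implicit.
Unset Printing Implicit Defensive.

Local Open Scope nat_scope.
Local Open Scope classical_set_scope.

Lemma exists_prime_above (m : nat) : exists p, (m < p) && prime p.
Proof. by have [p lt_mp pr_p] := prime_above m; exists p; rewrite lt_mp. Qed.

Definition next_prime (m : nat) : nat := ex_minn (exists_prime_above m).

(* Indexed from 1: nth_prime 1 = 2, nth_prime 2 = 3, and so on; the value
   nth_prime 0 = 0 carries no meaning. *)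
Definition nth_prime (i : nat) : nat := iter i next_prime 0.

Definition primorial (k : nat) : nat := \prod_(1 <= i < k.+1) nth_prime i.

Definition prime_multiples (k : nat) : set nat :=
  [set m | 0 < m /\ exists i, 1 <= i <= k /\ nth_prime i %| m].

(* A consists of positive integers and has no k + 1 pairwise coprime elements.
   These elements are distinct, so 1, although coprime to itself, counts once. *)
Definition coprime_free (k : nat) (A : set nat) : Prop :=
  A `<=` [set m | 0 < m] /\
  ~ exists s : seq nat,
      [/\ size s = k.+1, uniq s, forall x, x \in s -> A x & pairwise coprime s].

Definition initial (A : set nat) (n : nat) : set nat :=
  A `&` [set m | 1 <= m <= n].

(* fset_set returns the empty set on infinite sets; initial A n is finite. *)
Definition count_upto (A : set nat) (n : nat) : nat :=
  #|` fset_set (initial A n)|%fset.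

(* Main.v *)
(** Cut the integers into blocks Pt + 2, ..., Pt + P + 1 with P = P_k.  Two
    offsets i, j such that i - j has only prime factors dividing P and no prime
    factor of P divides both i and j give coprime numbers in every block, and A
    contains at most k elements of a clique of such offsets.  Disjoint cliques
    therefore force A to miss at least phi(P) elements of each block.

    Let r be a residue, suppose a divides Pt + r, and let i be an offset such
    that i - r has only prime factors dividing P.  Then a is coprime to Pt + i,
    so on a clique of such offsets A \ {a} has at most k - 1 elements.  For
    s = phi(P_(k-1)) (p_(k+1) - p_k) suitable residues r this yields one further
    missing element.  Differences of these residues are coprime to a, so no
    block is counted twice, and as a is coprime to P each residue contributes
    at least T/a - 1 of the first T blocks. *)
Require Import Defs.
From mathcomp Require Import all_boot all_order all_algebra finmap.
From mathcomp Require Import boolp classical_sets functions cardinality reals.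
From mathcomp Require Import zify ring lra.
Set Implicit Arguments.
Unset Strict Implicit.
Unset Printing Implicit Defensive.
Import Order.TTheory GRing.Theory Num.Theory.
Local Open Scope classical_set_scope.
Local Open Scope ring_scope.

Section Blocks.
Local Open Scope nat_scope.

(** * Coprimality that persists from block to block *)

(** One of the truncated differences is 0, so the sum is |i - j|. As [\pi(P).-nat] fails at 0, the
    relation is irreflexive. *)
Definition smooth_gap (P i j : nat) : bool := \pi(P).-nat ((i - j) + (j - i)).

Definition stably_coprime (P i j : nat) : bool :=
  smooth_gap P i j && coprime (gcdn i j) P.

Lemma dvdn_gap (g m i j : nat) :
  g %| m + i -> g %| m + j -> g %| (i - j) + (j - i).
Proof.
move=> gi gj; case/orP: (leq_total i j) => [ij|ji].
  have -> : i - j + (j - i) = (m + j) - (m + i) by rewrite subnDl (eqP ij).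
  exact: dvdn_sub.
have -> : i - j + (j - i) = (m + i) - (m + j) by rewrite subnDl (eqP ji) addn0.
exact: dvdn_sub.
Qed.

Lemma coprime_smooth (P d g : nat) :
  0 < P -> 0 < g -> coprime P g -> \pi(P).-nat d -> coprime d g.
Proof. by move=> P_gt0 g_gt0; rewrite coprime_pi' // => /[swap]; apply: pnat_coprime. Qed.

(** The gcd divides the gap, so its primes divide [P]; such a prime would then divide both [i] and
    [j]. *)
Lemma stably_coprime_shift (P t i j : nat) :
  0 < P -> stably_coprime P i j -> coprime (P * t + i) (P * t + j).
Proof.
move=> P_gt0 /andP[gap cop].
set g := gcdn (P * t + i) (P * t + j).
have gP : \pi(P).-nat g.
  by apply: pnat_dvd gap; apply: (dvdn_gap (m := P * t)); rewrite ?dvdn_gcdl ?dvdn_gcdr.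
have dvd_off x : g %| P * t + x -> gcdn g P %| x.
  move=> gx; rewrite -(@dvdn_addr (P * t)); last by rewrite dvdn_mulr ?dvdn_gcdr.
  by rewrite (dvdn_trans (dvdn_gcdl _ _)).
have cgP : coprime P g.
  rewrite coprime_sym /coprime -dvdn1 -(eqP cop) !dvdn_gcd dvdn_gcdr.
  by rewrite !dvd_off ?dvdn_gcdl ?dvdn_gcdr.
have g_gt0 : 0 < g by case/andP: gP.
by have := coprime_smooth P_gt0 g_gt0 cgP gP; rewrite /coprime gcdnn.
Qed.

(** A common divisor of [a] and [m + v] also divides [m + r], hence the gap, which is coprime to
    [a]. *)
Lemma smooth_gap_coprime (P a m r v : nat) :
  0 < P -> 0 < a -> coprime P a -> a %| m + r -> smooth_gap P r v ->
  coprime a (m + v).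
Proof.
move=> P_gt0 a_gt0 cPa ar gap.
have := coprime_smooth P_gt0 a_gt0 cPa gap; rewrite coprime_sym /coprime -dvdn1.
set g := gcdn a (m + v) => cop.
rewrite -dvdn1 (dvdn_trans _ cop) // dvdn_gcd dvdn_gcdl /=.
by apply: (dvdn_gap (m := m)); rewrite ?dvdn_gcdr // (dvdn_trans _ ar) ?dvdn_gcdl.
Qed.

(** * Clique packings and missing elements *)

Definition clique_packing (P : nat) (cs : seq (seq nat)) : bool :=
  [&& uniq (flatten cs), all (fun v => v \in iota 2 P) (flatten cs)
    & all (pairwise (stably_coprime P)) cs].

Definition clique_deficit_near (P k r : nat) (c : seq nat) : nat :=
  if all (smooth_gap P r) c then size c - k.-1 else size c - k.

(** Disjoint cliques miss distinct elements, so the lower bounds [f c] add up. *)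
Lemma packing_deficit (P : nat) (C : pred nat) (f : seq nat -> nat)
    (cs : seq (seq nat)) :
  clique_packing P cs ->
  (forall c : seq nat, uniq c -> pairwise (stably_coprime P) c ->
    count C c + f c <= size c) ->
  count C (iota 2 P) + sumn (map f cs) <= P.
Proof.
case/and3P=> uniq_cs /allP sub_cs cl fP.
have: forall s, count C s + count (predC C) s = size s by exact: count_predC.
move: (predC C) => D countD.
have: count D (flatten cs) <= count D (iota 2 P).
  rewrite -!size_filter; apply: uniq_leq_size; first exact: filter_uniq.
  by move=> v; rewrite !mem_filter => /andP[-> /sub_cs].
have: sumn (map f cs) <= count D (flatten cs).
  move: uniq_cs cl {sub_cs}; elim: cs => //= c cs IH.
  rewrite cat_uniq count_cat => /and3P[uc _ ucs] /andP[pc pcs].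
  by apply: leq_add (IH ucs pcs); rewrite -(leq_add2l (count C c)) countD fP.
move=> le1 le2; rewrite -[leqRHS](size_iota 2) -countD leq_add2l.
exact: leq_trans le1 le2.
Qed.

(** [Q] serves two cases: [predT] for the bound [k], and [coprime a] for the bound [k.-1]. *)
Lemma count_clique (P t n : nat) (Q B : pred nat) (c : seq nat) :
  0 < P ->
  (forall s : seq nat, uniq s -> all B s -> all Q s -> pairwise coprime s -> size s <= n) ->
  uniq c -> pairwise (stably_coprime P) c -> all (fun v => Q (P * t + v)) c ->
  count (fun v => B (P * t + v)) c <= n.
Proof.
move=> P_gt0 B_le uc pc Qc.
rewrite -size_filter -(size_map (addn (P * t))); apply: B_le.
- by rewrite map_inj_uniq ?filter_uniq //; apply: addnI.
- by rewrite all_map; apply: filter_all.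
- by rewrite all_map all_filter; apply: sub_all Qc => v /= ->; rewrite implybT.
rewrite pairwise_map; apply: pairwise_filter; apply: sub_pairwise pc => i j /=.
exact: stably_coprime_shift.
Qed.

(* [base] gives the deficit [e] of every block; an element [(r, cs)] of [near]
   gives the deficit [e + 1] of the blocks with [a %| P * t + r]. *)
Definition certificate (P k e : nat) (base : seq (seq nat))
    (near : seq (nat * seq (seq nat))) : bool :=
  [&& clique_packing P base, e <= sumn [seq size c - k | c <- base],
      all (fun rc => clique_packing P rc.2 &&
             (e < sumn (map (clique_deficit_near P k rc.1) rc.2))) near
    & pairwise (smooth_gap P) (map fst near)].

(** * Blocks hit by multiples of [a] *)

Lemma multiple_in_progression (P a r : nat) :
  0 < P -> 0 < a -> coprime P a -> exists2 u, u < a & a %| P * u + r.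
Proof.
move=> P_gt0 a_gt0 /(coprimeP _ P_gt0)[[x y] /= xy].
(* Here x P - y a = 1, so [x] inverts [P] modulo [a]; [a.-1] plays the role of -1. *)
exists (x * (r * a.-1) %% a); first exact: ltn_pmod.
rewrite /dvdn -modnDml modnMmr modnDml -/(dvdn _ _).
have -> : P * (x * (r * a.-1)) + r = a * (r + y * (r * a.-1)).
  have -> : P * (x * (r * a.-1)) = (x * P) * (r * a.-1) by ring.
  have -> : x * P = 1 + y * a by lia.
  by case: a a_gt0 {xy} => // a _ /=; ring.
exact: dvdn_mulr.
Qed.

(** Hits recur with period [a], and [T %/ a] full periods fit below [T]. *)
Lemma divn_le_hits (P a r T : nat) :
  0 < P -> 0 < a -> coprime P a ->
  T %/ a <= \sum_(0 <= t < T) (a %| P * t + r).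
Proof.
move=> P_gt0 a_gt0 cPa.
have [u u_lt au] := multiple_in_progression r P_gt0 a_gt0 cPa.
have -> : \sum_(0 <= t < T) (a %| P * t + r)
          = count (fun t => a %| P * t + r) (iota 0 T).
  rewrite -sum1_count [RHS]big_mkcond /index_iota subn0.
  by apply: eq_bigr => t _; case: (_ %| _).
rewrite -[leqLHS](size_iota 0) -(size_map (fun q => q * a + u)) -size_filter.
apply: uniq_leq_size.
  by rewrite map_inj_uniq ?iota_uniq // => q q' /addIn /eqP; rewrite eqn_pmul2r // => /eqP.
move=> _ /mapP[q + ->]; rewrite mem_iota mem_filter mem_iota /= !add0n => q_lt.
apply/andP; split.
  have -> : P * (q * a + u) + r = P * q * a + (P * u + r) by ring.
  by rewrite dvdn_addr // dvdn_mull.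
by have := leq_divM T a; nia.
Qed.

(** If two residues were hit at once, [a] would divide their gap, to which it is coprime; this
    forces a = 1. *)
Lemma hits_le1 (P a m : nat) (rs : seq nat) :
  0 < P -> 0 < a -> coprime P a -> pairwise (smooth_gap P) rs ->
  (a = 1 -> size rs <= 1) -> count (fun r => a %| m + r) rs <= 1.
Proof.
move=> P_gt0 a_gt0 cPa gaps a1.
have [/a1|a_neq1] := eqVneq a 1; first exact/leq_trans/count_size.
elim: rs gaps {a1} => //= r rs IH /andP[/allP gap_r /IH le1].
have [ar|//] := boolP (a %| m + r).
suff -> : count (fun r => a %| m + r) rs = 0 by [].
apply/eqP; rewrite -leqn0 leqNgt -has_count; apply/hasPn => r' /gap_r gap.
apply: contra a_neq1 => ar'.
have := coprime_smooth P_gt0 a_gt0 cPa gap; rewrite /coprime => /eqP <-.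
by rewrite eq_sym; apply/eqP/gcdn_idPr/(dvdn_gap ar).
Qed.

(** [B] stands for A without [a]. The bound holds block by block, with the base packing when there
    is no hit and the packing of the hit residue otherwise; then it is summed. *)
Lemma count_blocks (P k e a T : nat) (B : pred nat) (base : seq (seq nat))
    (near : seq (nat * seq (seq nat))) :
  0 < P -> 0 < a -> coprime P a ->
  (forall s : seq nat, uniq s -> all B s -> pairwise coprime s -> size s <= k) ->
  (forall s : seq nat, uniq s -> all B s -> all (coprime a) s -> pairwise coprime s ->
    size s <= k.-1) ->
  certificate P k e base near -> (a = 1 -> size near <= 1) ->
  count B (iota 2 (P * T)) + size near * (T %/ a) <= (P - e) * T.
Proof.
move=> P_gt0 a_gt0 cPa Bk Bak /and4P[base_ok base_e /allP near_ok gaps] a1.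
pose hits t := \sum_(rc <- near) (a %| P * t + rc.1).
have block t : count (fun v => B (P * t + v)) (iota 2 P) + (e + hits t) <= P.
  have le_k c : uniq c -> pairwise (stably_coprime P) c ->
      count (fun v => B (P * t + v)) c <= k.
    move=> uc pc; apply: (@count_clique P t k predT) => // [s us Bs _ ps|].
      exact: Bk.
    exact: all_predT.
  have hitsE : hits t = count (fun r => a %| P * t + r) (map fst near).
    rewrite /hits count_map -sum1_count [RHS]big_mkcond.
    by apply: eq_bigr => rc _ /=; case: (_ %| _).
  have le1 : hits t <= 1 by rewrite hitsE; apply: (@hits_le1 P) => //; rewrite size_map.
  have [hits0|] := posnP (hits t).
    rewrite hits0 addn0; apply: leq_trans (_ : _ <= count (fun v => B (P * t + v)) (iota 2 P)
                        + sumn [seq size c - k | c <- base]) _.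
      by rewrite leq_add2l.
    apply: packing_deficit => //.
    (* [count_size] covers cliques of size at most [k], whose truncated deficit is 0. *)
    move=> c uc pc; move: (le_k c uc pc) (count_size (fun v => B (P * t + v)) c).
    by move: (count _ c) => x; lia.
  move=> hits_gt0; have {le1} hits1 : hits t = 1 by lia.
  move: hits_gt0; rewrite hitsE -has_count has_map.
  case/hasP=> [[r cs] /near_ok /andP[/= cs_ok cs_e] /= ar].
  rewrite -hitsE hits1 addn1; apply: leq_trans (_ : _ <= count (fun v => B (P * t + v)) (iota 2 P)
                      + sumn (map (clique_deficit_near P k r) cs)) _.
    by rewrite leq_add2l.
  apply: packing_deficit => //.
  move=> c uc pc; move: (le_k c uc pc) (count_size (fun v => B (P * t + v)) c).
  rewrite /clique_deficit_near; case: ifP => [/allP gap_c|_]; last first.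
    by move: (count _ c) => x; lia.
  suff : count (fun v => B (P * t + v)) c <= k.-1 by move: (count _ c) => x; lia.
  apply: (@count_clique P t k.-1 (coprime a)) => //.
  by apply/allP => v /gap_c; apply: smooth_gap_coprime.
have sum_hits : size near * (T %/ a) <= \sum_(0 <= t < T) hits t.
  rewrite /hits exchange_big /= mulnC -iter_addn_0 -count_predT -big_const_seq.
  by apply: leq_sum => rc _; apply: divn_le_hits.
apply: leq_trans (_ : count B (iota 2 (P * T)) + \sum_(0 <= t < T) hits t <= _).
  by rewrite leq_add2l.
elim: T {sum_hits} => [|T IH]; first by rewrite !muln0 big_geq.
have shift : count B (iota (2 + P * T) P) = count (fun v => B (P * T + v)) (iota 2 P).
  by rewrite addnC iotaDl count_map.
rewrite big_nat_recr //= mulnSr iotaD count_cat shift.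
move: (block T) IH; rewrite mulnSr.
move: (count B (iota 2 _)) (count _ (iota 2 P)) => x y.
move: (\sum_(0 <= i < T) hits i) (hits T) (P * T) => S h N.
lia.
Qed.

(** * The first primes and primorials *)

Lemma nth_prime_succ (i p : nat) :
  nth_prime i < p -> prime p ->
  (forall q, nth_prime i < q < p -> ~~ prime q) -> nth_prime i.+1 = p.
Proof.
move=> lt_p pr_p gap; rewrite /nth_prime iterS -/(nth_prime i) /next_prime.
case: ex_minnP => q /andP[lt_q pr_q] q_min; apply/eqP.
rewrite eqn_leq q_min ?lt_p //= leqNgt; apply/negP => lt_qp.
by have := gap q; rewrite lt_q lt_qp pr_q => /(_ isT).
Qed.

Lemma nth_prime1 : nth_prime 1 = 2.
Proof. by apply: nth_prime_succ => // -[|[|q]]. Qed.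

Lemma nth_prime2 : nth_prime 2 = 3.
Proof. by apply: nth_prime_succ; rewrite ?nth_prime1 // => -[|[|[|q]]]. Qed.

Lemma nth_prime3 : nth_prime 3 = 5.
Proof. by apply: nth_prime_succ; rewrite ?nth_prime2 // => -[|[|[|[|[|q]]]]]. Qed.

Lemma nth_prime4 : nth_prime 4 = 7.
Proof. by apply: nth_prime_succ; rewrite ?nth_prime3 // => -[|[|[|[|[|[|[|q]]]]]]]. Qed.

Lemma prime_nth_prime (i : nat) : prime (nth_prime i.+1).
Proof.
rewrite /nth_prime iterS -/(nth_prime i) /next_prime.
by case: ex_minnP => q /andP[].
Qed.

Lemma coprime_primorial (k a : nat) :
  0 < a -> ~ prime_multiples k a -> coprime (primorial k) a.
Proof.
move=> a_gt0 aE; rewrite /primorial big_nat_cond.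
apply: (big_ind (fun x => coprime x a)); first exact: coprime1n.
  by move=> x y cx cy; rewrite coprimeMl cx.
case=> [|i] // /andP[i_le _]; rewrite prime_coprime ?prime_nth_prime //.
by apply/negP => dvd; apply: aE; split => //; exists i.+1.
Qed.

(** * From blocks to coprime-free sets *)

Lemma coprime_free_size (k : nat) (A : set nat) (s : seq nat) :
  coprime_free k A -> uniq s -> all (fun x => x \in A) s -> pairwise coprime s ->
  size s <= k.
Proof.
move=> [_ Afree] us /allP sA ps; rewrite leqNgt; apply/negP => lt_k.
apply: Afree; exists (take k.+1 s); split.
- by rewrite size_takel.
- exact: take_uniq.
- by move=> x /mem_take /sA; rewrite inE.
- exact: subseq_pairwise (take_subseq _ _) ps.
Qed.

(** The 2 pays for [a] and for 1, which precedes the first block; [iota 2 N] ends at N + 1. *)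
Lemma count_upto_le (A : set nat) (a n N : nat) : n <= N.+1 ->
  count_upto A n <= count (fun x => (x \in A) && (x != a)) (iota 2 N) + 2.
Proof.
move=> n_le; rewrite /count_upto addn2 -size_filter.
have fin : finite_set (initial A n).
  by apply: sub_finite_set (finite_II n.+1) => x [_ /andP[_]].
set s := filter _ _; rewrite -[leqRHS]/(size [:: 1, a & s]).
apply: uniq_leq_size; first exact: fset_uniq.
move=> x; rewrite in_fset_set // inE => -[xA /= /andP[x_gt0 x_le]].
rewrite !inE mem_filter mem_iota mem_set //=.
have [->|x_neq1] := eqVneq x 1 => //=; have [//|x_neqa] := eqVneq x a => /=.
lia.
Qed.

Lemma coprime_free_count (k a P e T : nat) (A : set nat) (base : seq (seq nat))
    (near : seq (nat * seq (seq nat))) :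
  0 < P -> coprime P a -> coprime_free k A -> A a ->
  certificate P k e base near -> (a = 1 -> size near <= 1) ->
  count (fun x => (x \in A) && (x != a)) (iota 2 (P * T)) + size near * (T %/ a)
    <= (P - e) * T.
Proof.
move=> P_gt0 cPa Afree Aa cert a1.
have a_gt0 : 0 < a by case: Afree => /(_ a Aa).
apply: count_blocks cert a1 => // s us Bs.
  by apply: (coprime_free_size Afree us); apply: sub_all Bs => x /andP[].
(* Since [B] omits [a], adjoining [a] to [s] creates no repetition. *)
move=> ca ps; suff : size (a :: s) <= k by case: (k).
apply: (coprime_free_size Afree); rewrite /= ?us ?ca ?mem_set ?andbT //.
  by apply/negP => /(allP Bs); rewrite eqxx andbF.
by apply: sub_all Bs => x /andP[].
Qed.

End Blocks.

(** * Density bound and certificates for k = 1, 2, 3 *)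

(** In the constant, P - e pays for rounding [n] up to whole blocks, [size near] for rounding down T
    / a once per residue, and 2 for the elements 1 and [a]. *)
Lemma coprime_free_density (R : realType) (k P e : nat) (base : seq (seq nat))
    (near : seq (nat * seq (seq nat))) (A : set nat) (a n : nat) :
  (0 < P)%N -> (e <= P)%N -> coprime P a -> coprime_free k A -> A a ->
  certificate P k e base near -> (a = 1%N -> size near <= 1)%N ->
  (count_upto A n)%:R <=
    ((P%:R - e%:R) * a%:R - (size near)%:R) / (P%:R * a%:R) * n%:R
    + (P%:R - e%:R + (size near)%:R + 2) :> R.
Proof.
move=> P_gt0 e_le cPa Afree Aa cert a1.
have a_gt0 : (0 < a)%N by case: Afree => /(_ a Aa).
pose T := (n %/ P).+1.
have n_le : (n <= P * T)%N by rewrite mulnC ltnW // ltn_ceil.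
have T_le : (P * T <= n + P)%N by rewrite mulnS addnC leq_add2r mulnC leq_divM.
have q_ge : (T <= T %/ a * a + a)%N by rewrite -mulSnr ltnW // ltn_ceil.
have := coprime_free_count T P_gt0 cPa Afree Aa cert a1.
have := count_upto_le A a (leqW n_le).
move: (count _ _) (T %/ a)%N q_ge T_le n_le => M q.
move: T (size near) => T s; rewrite -!(ler_nat R) !(natrD, natrM, natrB) //.
have : 0 < P%:R :> R by rewrite ltr0n.
have : 1 <= a%:R :> R by rewrite ler1n.
have : 0 <= s%:R :> R by [].
have : e%:R <= P%:R :> R by rewrite ler_nat.
move: (P%:R) (e%:R) (a%:R) (s%:R) (T%:R) (q%:R) (M%:R) (n%:R) ((count_upto A n)%:R).
move=> p f x s' t q' m n' c fp s0 x1 p0 xq tp np cm mt.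
have -> : ((p - f) * x - s') / (p * x) * n' = (p - f) * (n' / p) - s' * (n' / p / x).
  by field; rewrite !gt_eqF //; lra.
have y1 : n' / p <= t by rewrite ler_pdivrMr // mulrC.
have y2 : t <= n' / p + 1 by rewrite -lerBlDr ler_pdivlMr //; lra.
have y3 : n' / p / x <= q' + 1 by rewrite ler_pdivrMr; nra.
nra.
Qed.

(** For k > 1 the value a = 1 must be excluded: with k = 2, the even numbers together with 1 have
    density 1/2, but the bound would give 1/3. With k = 3, adding 1 to the multiples of 2 or 3 gives
    2/3 against 3/5. *)
Theorem theorem2 (R : realType) (k : nat) (hk : k \in [:: 1; 2; 3]%N) :
  exists c : R,
    forall (A : set nat) (a n : nat),
      coprime_free k A ->
      (A `\` prime_multiples k) a ->
      ((1 < k)%N -> a <> 1%N) ->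
      (0 < n)%N ->
      (count_upto A n)%:R <=
        (((primorial k)%:R - (totient (primorial k))%:R) * a%:R
          - (totient (primorial k.-1))%:R
            * ((nth_prime k.+1)%:R - (nth_prime k)%:R))
        / ((primorial k)%:R * a%:R) * n%:R + c.
Proof.
have key base near :
    certificate (primorial k) k (totient (primorial k)) base near ->
    (size near = totient (primorial k.-1) * (nth_prime k.+1 - nth_prime k))%N ->
    (nth_prime k <= nth_prime k.+1)%N -> (0 < primorial k)%N ->
    (totient (primorial k) <= primorial k)%N ->
    (k = 1 -> size near = 1)%N ->
    exists c : R, forall A a n, coprime_free k A -> (A `\` prime_multiples k) a ->
      ((1 < k)%N -> a <> 1%N) -> (0 < n)%N ->
      (count_upto A n)%:R <=
        (((primorial k)%:R - (totient (primorial k))%:R) * a%:R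
          - (totient (primorial k.-1))%:R
            * ((nth_prime k.+1)%:R - (nth_prime k)%:R))
        / ((primorial k)%:R * a%:R) * n%:R + c.
  move=> cert near_size le_p P_gt0 phi_le near1.
  eexists=> A a n Afree [Aa aE] a_neq1 _.
  have a_gt0 : (0 < a)%N by case: Afree => /(_ a Aa).
  have -> : (totient (primorial k.-1))%:R * ((nth_prime k.+1)%:R - (nth_prime k)%:R)
            = (size near)%:R :> R by rewrite near_size natrM natrB.
  apply: (coprime_free_density R n P_gt0 phi_le _ Afree Aa cert).
  - exact: coprime_primorial.
  (* Only k = 1 admits a = 1, and there a single residue is used. *)
  - move=> a1; case: (ltnP 1 k) => [/a_neq1|]; first by rewrite a1.
    by case: (k) hk near1 => [|[|]] // _ ->.
have P1 : primorial 1 = 2%N by rewrite /primorial big_nat1 nth_prime1.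
have P2 : primorial 2 = 6%N by rewrite /primorial big_nat_recr // -/(primorial 1) P1 nth_prime2.
have P3 : primorial 3 = 30%N by rewrite /primorial big_nat_recr // -/(primorial 2) P2 nth_prime3.
have P0 : primorial 0 = 1%N by rewrite /primorial big_geq.
move: hk key; rewrite !inE => /or3P[] /eqP->.
(* The packings were found by computer search.  With k = 3 and blocks starting
   at offset 1 no base packing has deficit 8, whence the offset 2. *)
- rewrite P0 P1 nth_prime1 nth_prime2 => key.
  (* The residue 4 lies outside the offsets 2, 3; a residue need not be an offset. *)
  by apply: (key [:: [:: 2; 3]]%N [:: (4, [:: [:: 2]; [:: 3]])]%N).
- rewrite P1 P2 nth_prime2 nth_prime3 => key.
  by apply: (key [:: [:: 3; 4; 5; 7]]%N
    [:: (4, [:: [:: 2; 3]; [:: 5; 6; 7]]); (6, [:: [:: 3; 4; 5; 7]])]%N).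
- rewrite P2 P3 nth_prime3 nth_prime4 => key.
  (* The base deficit is 4 + 4 = 8, and each packing in [near] reaches 9. The residues differ by 4,
     8, 12 or 20. *)
  by apply: (key [:: [:: 5; 7; 8; 9; 11; 13; 17]; [:: 19; 23; 25; 27; 28; 29; 31]]%N
    [:: (1, [:: [:: 11; 13; 16; 17; 19; 21]; [:: 23; 25; 27; 28; 29; 31]; [:: 4; 5; 7; 9]]);
        (9, [:: [:: 3; 5; 7; 8; 11; 13]; [:: 19; 23; 25; 27; 28; 29; 31]; [:: 14; 15; 17]]);
        (13, [:: [:: 5; 9; 11; 13; 14; 17; 29]; [:: 19; 21; 22; 23; 25; 31]; [:: 7; 15; 16]]);
        (21, [:: [:: 17; 23; 25; 26; 27; 29]; [:: 4; 5; 7; 9];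
                 [:: 11; 13; 15; 16; 19; 31]])]%N).
Qed.
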